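(* Let $G=(V,E)$ be a finite undirected graph without multi-edges or self-loops, and let $(J_{x,y})_{x,y\in V}$ be nonnegative real numbers with $J_{x,y}=J_{y,x}$ for all $x,y\in V$ and $J_{x,y}=0$ whenever $\{x,y\}\notin E$ (in particular $J_{x,x}=0$). Let $\Omega=\{-1,+1\}^V$ and let $H$ be the Hamiltonian of the ferromagnetic Ising model without external fields, $$H(\sigma)=-\frac12\sum_{x,y\in V}J_{x,y}\sigma_x\sigma_y,\qquad \sigma\in\Omega .$$ Let $\beta\in(0,\infty)$, let $\pi_\beta^{\mathrm{G}}(\sigma)=e^{-\beta H(\sigma)}/\sum_{\tau\in\Omega}e^{-\beta H(\tau)}$ be the Gibbs distribution, and let $\pi_\beta^{\mathrm{DA}}$ be the unique stationary distribution of the Digital Annealer transition matrix $P_\beta^{\mathrm{DA}}$ associated with $H$ (defined in the context). Then $\pi_\beta^{\mathrm{DA}}=\pi_\beta^{\mathrm{G}}$ if and only if $J_{x,y}=0$ for all $x,y\in V$.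
   Context: For $\sigma\in\Omega=\{-1,+1\}^V$ and $x\in V$, $\sigma^x\in\Omega$ denotes the configuration with $(\sigma^x)_x=-\sigma_x$ and $(\sigma^x)_y=\sigma_y$ for $y\ne x$. Put $E_x(\sigma)=H(\sigma^x)-H(\sigma)$ and $E_x(\sigma)^+=\max\{E_x(\sigma),0\}$. For $\beta\in(0,\infty)$ the Digital Annealer transition matrix $P_\beta^{\mathrm{DA}}$ on $\Omega$ is defined by: - if $\tau=\sigma^x$ for some $x\in V$, $$P_\beta^{\mathrm{DA}}(\sigma,\tau)=\sum_{S\subseteq V,\ S\ni x}\frac1{|S|}\prod_{y\in S}e^{-\beta E_y(\sigma)^+}\prod_{y\in V\setminus S}\bigl(1-e^{-\beta E_y(\sigma)^+}\bigr);$$ - if $\tau=\sigma$, $P_\beta^{\mathrm{DA}}(\sigma,\sigma)=\prod_{y\in V}\bigl(1-e^{-\beta E_y(\sigma)^+}\bigr)$; - $P_\beta^{\mathrm{DA}}(\sigma,\tau)=0$ otherwise. This is an irreducible stochastic matrix on the finite set $\Omega$, so it has a unique stationary distribution, denoted $\pi_\beta^{\mathrm{DA}}$. *)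

(* Defs.v *)
From HB Require Import structures.
From mathcomp Require Import all_boot all_order all_algebra.
From mathcomp Require Import boolp classical_sets reals sequences exp.

Set Implicit Arguments.
Unset Strict Implicit.
Unset Printing Implicit Defensive.

Import Order.TTheory GRing.Theory Num.Theory.
Local Open Scope ring_scope.

Section FiniteMarkovChain.
Context {R : realType} {T : finType}.
Implicit Types (P : T -> T -> R) (mu : {ffun T -> R}).

Definition is_stochastic P :=
  (forall s t, 0 <= P s t) /\ (forall s, \sum_t P s t = 1).

Definition is_irreducible P := forall s t, connect (fun a b => 0 < P a b) s t.

Definition is_stationary P mu :=
  [/\ forall s, 0 <= mu s, \sum_s mu s = 1
    & forall t, \sum_s mu s * P s t = mu t].

(* For P stochastic and irreducible on a nonempty T the default 0 is not used: see
   [exists_unique_stationary] and [stationary_distribution_spec]. *)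
Definition stationary_distribution P : {ffun T -> R} :=
  xget 0 [set mu | is_stationary P mu]%classic.

Lemma invariant_norm P (v : T -> R) : is_stochastic P ->
  (forall t, \sum_s v s * P s t = v t) ->
  forall t, \sum_s `|v s| * P s t = `|v t|.
Proof.
move=> [P0 P1] vP.
have le t : `|v t| <= \sum_s `|v s| * P s t.
  rewrite -{1}vP; apply: le_trans (ler_norm_sum _ _ _) _.
  by apply: ler_sum => s _; rewrite normrM (ger0_norm (P0 _ _)).
have eqS : \sum_t (\sum_s `|v s| * P s t - `|v t|) = 0.
  rewrite sumrB exchange_big /=; apply/eqP; rewrite subr_eq0; apply/eqP.
  by apply: eq_bigr => s _; rewrite -mulr_sumr P1 mulr1.
move=> t; apply/eqP; rewrite -subr_eq0; apply/eqP.
by apply: (psumr_eq0P _ eqS) => // i _; rewrite subr_ge0.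
Qed.

Lemma invariant_eq0 P (u : T -> R) : is_stochastic P -> is_irreducible P ->
  (forall s, 0 <= u s) -> (forall t, \sum_s u s * P s t = u t) ->
  forall a, u a = 0 -> forall b, u b = 0.
Proof.
move=> [P0 _] irr u0 uP a ua b.
have step c d : 0 < P c d -> u d = 0 -> u c = 0.
  move=> Pcd ud; have := uP d; rewrite ud => /psumr_eq0P h.
  have /h/(_ c isT)/eqP : forall s, true -> 0 <= u s * P s d.
    by move=> s _; rewrite mulr_ge0.
  by rewrite mulf_eq0 (gt_eqF Pcd) orbF => /eqP.
case/connectP: (irr b a) => p; elim: p b => [|c p IH] b /=.
  by move=> _ <-.
by case/andP=> bc cp /(IH _ cp); apply: step.
Qed.

Lemma stationary_exists P : (0 < #|T|)%N -> is_stochastic P ->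
  exists mu, is_stationary P mu.
Proof.
move=> T0 Pst; have [P0 P1] := Pst.
have sumE (F : T -> R) : \sum_(i < #|T|) F (enum_val i) = \sum_s F s.
  by rewrite [RHS](reindex (@enum_val T T)) //; exact/onW_bij/enum_val_bij.
pose A : 'M[R]_#|T| := \matrix_(i, j) P (enum_val i) (enum_val j).
have AC : (A - 1%:M) *m (const_mx 1 : 'cV_#|T|) = 0.
  rewrite mulmxBl mul1mx; apply/matrixP => i j; rewrite !mxE.
  under eq_bigr => k _ do rewrite !mxE mulr1.
  by rewrite (sumE (P (enum_val i))) P1 subrr.
have /eqP/det0P[v v0 vA] : \det (A - 1%:M) = 0.
  apply/eqP; rewrite -det_tr; apply/det0P; exists (const_mx 1).
    apply/eqP => /rowP/(_ (Ordinal T0)); rewrite !mxE.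
    exact/eqP/oner_neq0.
  by rewrite -trmx_const -trmx_mul AC trmx0.
pose u s := v 0 (enum_rank s).
have uP t : \sum_s u s * P s t = u t.
  move/eqP: vA; rewrite mulmxBr mulmx1 subr_eq0 => /eqP/rowP/(_ (enum_rank t)).
  rewrite mxE -/(u t) => <-; rewrite -sumE; apply: eq_bigr => i _.
  by rewrite /u !mxE enum_valK enum_rankK.
have nP := invariant_norm Pst uP.
pose N := \sum_s `|u s|.
have N0 : N != 0.
  apply: contraNneq v0 => /psumr_eq0P uz; apply/eqP/rowP => i; rewrite mxE.
  by apply/eqP; rewrite -normr_eq0 -(enum_valK i) uz.
exists [ffun s => `|u s| / N]; split=> [s||t].
- by rewrite ffunE divr_ge0 ?sumr_ge0.
- by under eq_bigr do rewrite ffunE; rewrite -mulr_suml divff.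
- rewrite ffunE -nP mulr_suml; apply: eq_bigr => s _.
  by rewrite ffunE mulrAC.
Qed.

Lemma stationary_unique P mu nu : is_stochastic P -> is_irreducible P ->
  is_stationary P mu -> is_stationary P nu -> mu = nu.
Proof.
move=> Pst irr [_ mu1 muP] [_ nu1 nuP].
pose w s := mu s - nu s.
have wP t : \sum_s w s * P s t = w t.
  by under eq_bigr do rewrite mulrBl; rewrite sumrB muP nuP.
have w0 : \sum_s w s = 0 by rewrite sumrB mu1 nu1 subrr.
have nP := invariant_norm Pst wP.
pose u s := `|w s| + w s.
have uP t : \sum_s u s * P s t = u t.
  by under eq_bigr do rewrite mulrDl; rewrite big_split /= nP wP.
have u0 s : 0 <= u s by rewrite /u -lerBlDr sub0r -normrN ler_norm.
have wle s : w s <= 0.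
  have [//|ws] := leP (w s) 0.
  have [a wa] : exists a, w a <= 0.
    apply: contrapT => /forallNP wpos; have wp t : 0 < w t.
      by rewrite ltNge; apply/negP/wpos.
    have /psumr_eq0P/(_ w0 s isT) e : forall t, true -> 0 <= w t.
      by move=> t _; exact: ltW.
    by move: ws; rewrite e ltxx.
  have /(_ s) : forall b, u b = 0.
    by apply: (invariant_eq0 Pst irr u0 uP (a := a)); rewrite /u ler0_norm // addNr.
  by rewrite /u gtr0_norm // => ww; have := addr_gt0 ws ws; rewrite ww ltxx.
apply/ffunP => s; apply/eqP; rewrite -subr_eq0 -oppr_eq0; apply/eqP.
apply: (psumr_eq0P (P := xpredT) (F := fun s => - w s)) => // [t _|]; first by rewrite oppr_ge0.
by rewrite sumrN; move/eqP: w0; rewrite -oppr_eq0 => /eqP.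
Qed.

Lemma exists_unique_stationary P :
  (0 < #|T|)%N -> is_stochastic P -> is_irreducible P ->
  exists! mu, is_stationary P mu.
Proof.
move=> T0 Pst irr; have [mu muP] := stationary_exists T0 Pst.
by exists mu; split=> // nu; exact: stationary_unique.
Qed.

Lemma stationary_distribution_spec P :
  (0 < #|T|)%N -> is_stochastic P ->
  is_stationary P (stationary_distribution P).
Proof.
move=> T0 Pst.
exact: (@xgetPex _ _ [set mu | is_stationary P mu]%classic (stationary_exists T0 Pst)).
Qed.

End FiniteMarkovChain.

(* The sign of a spin is encoded as a boolean: true is +1 and false is -1. *)
Definition configuration (V : finType) : finType := {ffun V -> bool}.

Section DigitalAnnealer.
Context {R : realType} {V : finType}.

Implicit Types (sigma tau : configuration V) (H : configuration V -> R) (beta : R).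

Definition spin sigma x : R := if sigma x then 1 else -1.

Definition flip sigma x : configuration V :=
  [ffun y => if y == x then ~~ sigma y else sigma y].

Definition ising (J : V -> V -> R) sigma : R :=
  - (2^-1 * \sum_x \sum_y J x y * spin sigma x * spin sigma y).

Definition gibbs H beta : {ffun configuration V -> R} :=
  [ffun sigma => expR (- (beta * H sigma)) / \sum_tau expR (- (beta * H tau))].

Definition energy_gap H sigma x : R := H (flip sigma x) - H sigma.

Definition accept H beta sigma x : R :=
  expR (- (beta * Num.max (energy_gap H sigma x) 0)).

Definition DA_flip H beta sigma x : R :=
  \sum_(S : {set V} | x \in S)
    #|S|%:R^-1 * (\prod_(y in S) accept H beta sigma y)
               * (\prod_(y in ~: S) (1 - accept H beta sigma y)).

Definition DA_stay H beta sigma : R := \prod_y (1 - accept H beta sigma y).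

Definition DA_matrix H beta sigma tau : R :=
  if [pick x | tau == flip sigma x] is Some x then DA_flip H beta sigma x
  else if tau == sigma then DA_stay H beta sigma
  else 0.

Definition DA_stationary H beta : {ffun configuration V -> R} :=
  stationary_distribution (DA_matrix H beta).

Lemma flip_inj sigma : injective (flip sigma).
Proof.
move=> x y /ffunP/(_ x); rewrite !ffunE eqxx.
by case: eqP => // _; case: (sigma x).
Qed.

Lemma flip_neq sigma x : flip sigma x != sigma.
Proof. by apply/eqP => /ffunP/(_ x); rewrite ffunE eqxx; case: (sigma x). Qed.

Lemma DA_matrix_flip H beta sigma x :
  DA_matrix H beta sigma (flip sigma x) = DA_flip H beta sigma x.
Proof.
rewrite /DA_matrix; case: pickP => [y /eqP/flip_inj-> //|].
by move/(_ x); rewrite eqxx.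
Qed.

Lemma DA_matrix_stay H beta sigma :
  DA_matrix H beta sigma sigma = DA_stay H beta sigma.
Proof.
rewrite /DA_matrix; case: pickP => [y|_]; last by rewrite eqxx.
by rewrite eq_sym (negPf (flip_neq _ _)).
Qed.

Lemma DA_matrix_sum H beta sigma :
  \sum_tau DA_matrix H beta sigma tau =
  DA_stay H beta sigma + \sum_x DA_flip H beta sigma x.
Proof.
rewrite (bigD1 sigma) //= DA_matrix_stay; congr (_ + _).
rewrite (bigID (fun tau => tau \in codom (flip sigma))) /= [X in _ + X]big1 ?addr0.
  rewrite (eq_bigl (fun tau => tau \in [set flip sigma x | x in V])).
    rewrite big_imset /=; last by move=> x y _ _; exact: flip_inj.
    by apply: eq_bigr => x _; rewrite DA_matrix_flip.
  move=> tau; apply/andP/imsetP => [[_ /codomP[x ->]]|[x _ ->]]; first by exists x.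
  by rewrite flip_neq codom_f.
move=> tau /andP[ts tc]; rewrite /DA_matrix; case: pickP => [x /eqP te|_].
  by rewrite te codom_f in tc.
by rewrite (negPf ts).
Qed.

Lemma accept_gt0 H beta sigma x : 0 < accept H beta sigma x.
Proof. exact: expR_gt0. Qed.

Lemma accept_le1 H beta sigma x : 0 < beta -> accept H beta sigma x <= 1.
Proof.
move=> b0; rewrite -expR0 ler_expR oppr_le0 mulr_ge0 ?(ltW b0) //.
by rewrite le_max lexx orbT.
Qed.

Lemma DA_stochastic H beta : 0 < beta -> is_stochastic (DA_matrix H beta).
Proof.
move=> b0; split=> [s t|s].
  rewrite /DA_matrix; case: pickP => [x _|_].
    apply: sumr_ge0 => S _; rewrite !mulr_ge0 ?invr_ge0 ?prodr_ge0 // => y _.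
      exact/ltW/accept_gt0.
    by rewrite subr_ge0 accept_le1.
  by case: eqP => // _; apply: prodr_ge0 => y _; rewrite subr_ge0 accept_le1.
rewrite DA_matrix_sum.
pose w (S : {set V}) := (\prod_(y in S) accept H beta s y)
                       * (\prod_(y in ~: S) (1 - accept H beta s y)).
have -> : DA_stay H beta s = w finset.set0.
  by rewrite /w big_set0 mul1r finset.setC0; apply: eq_bigl => y; rewrite inE.
have -> : \sum_x DA_flip H beta s x = \sum_(S : {set V} | S != finset.set0) w S.
  under eq_bigr => x _ do rewrite /DA_flip.
  rewrite (exchange_big_dep predT) //= (bigD1 finset.set0) //= big1 ?add0r.
    apply: eq_bigr => S S0; rewrite sumr_const -mulrA -/(w S) -mulrnAl -[_^-1 *+ _]mulr_natl.
    by rewrite divff ?mul1r // pnatr_eq0 cards_eq0.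
  by move=> x; rewrite inE.
rewrite -(bigD1 (P := predT) finset.set0) //=.
transitivity (\prod_y (accept H beta s y + (1 - accept H beta s y))).
  rewrite bigA_distr; apply: eq_bigr => S _.
  rewrite (bigID (mem S)) /=; congr (_ * _).
    by apply: eq_bigr => y ->.
  by apply: eq_big => [y|y]; rewrite inE // => /negPf ->.
by rewrite big1 // => y _; rewrite addrC subrK.
Qed.

Lemma DA_flip_gt0 H beta sigma x : 0 < beta -> 0 < DA_flip H beta sigma x.
Proof.
move=> b0; rewrite /DA_flip (bigD1 (finset.setT)) ?inE //= ltr_pwDl //.
  rewrite finset.setCT big_set0 mulr1 mulr_gt0 //; last first.
    by apply: prodr_gt0 => y _; exact: accept_gt0.
  by rewrite invr_gt0 ltr0n cardsT; apply/card_gt0P; exists x.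
apply: sumr_ge0 => S _; rewrite !mulr_ge0 ?invr_ge0 ?prodr_ge0 // => y _.
  exact/ltW/accept_gt0.
by rewrite subr_ge0 accept_le1.
Qed.

Lemma DA_irreducible H beta : 0 < beta -> is_irreducible (DA_matrix H beta).
Proof.
move=> b0 s t; have [n] := ubnP #|[set x | s x != t x]%SET|.
elim: n s => // n IH s; rewrite ltnS => le.
have [|[x]] := set_0Vmem [set x | s x != t x]%SET.
  move/setP => e; have -> : s = t.
    by apply/ffunP => x; have := e x; rewrite !inE => /negbFE/eqP.
  exact: connect0.
rewrite inE => sx; apply: (connect_trans (y := flip s x)).
  by apply: connect1; rewrite DA_matrix_flip DA_flip_gt0.
apply: IH; apply: leq_trans le; apply/proper_card/properP; split.
  apply/fintype.subsetP => y; by rewrite !inE ffunE; have [->|] := eqVneq y x.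
exists x; rewrite !inE ?sx // ffunE eqxx negbK.
by move: sx; case: (s x); case: (t x).
Qed.

Lemma card_configuration_gt0 : (0 < #|configuration V|)%N.
Proof. by apply/card_gt0P; exists [ffun=> true]. Qed.

Lemma DA_stationaryP H beta mu : 0 < beta ->
  is_stationary (DA_matrix H beta) mu <-> mu = DA_stationary H beta.
Proof.
move=> b0; have Pst := DA_stochastic H b0; have irr := DA_irreducible H b0.
have DAs := stationary_distribution_spec card_configuration_gt0 Pst.
by split=> [mus|->]; [exact: stationary_unique mus DAs | exact: DAs].
Qed.

End DigitalAnnealer.

(* Main.v *)
(** Stationarity at a state [t] balances the flow into [t] against the flow out
    of [t]. Take [t] to be the all-plus ground state. The probability of flipping
    [x] is [accept x * E[1 / (1 + N)]], where [N] counts the accepted flips at the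
    other vertices. Ferromagnetism makes every other vertex at least as likely to
    accept in [t^x] as in [t], strictly so for a neighbour of [x], so [N] is
    stochastically larger in [t^x]. Hence, under the Gibbs distribution, each flow
    [t^x -> t] is at most the flow [t -> t^x], strictly if [x] has a neighbour.
    If [J = 0] the matrix is symmetric, so the uniform distribution is
    stationary. *)

Require Import Defs.
From mathcomp Require Import all_boot all_order all_algebra.
From mathcomp Require Import reals.
From mathcomp Require Import boolp sequences exp.
From mathcomp Require Import ring lra.

Set Implicit Arguments.
Unset Strict Implicit.
Unset Printing Implicit Defensive.

Import Order.TTheory GRing.Theory Num.Theory.
Local Open Scope ring_scope.

(** * Monotonicity of two-point averages in their values and in their weight *)

Section ConvexCombination.
Context {R : realFieldType}.
Implicit Types a b c x y : R.

Lemma ler_conv c x y x' y' : 0 <= c <= 1 -> x <= x' -> y <= y' ->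
  c * x + (1 - c) * y <= c * x' + (1 - c) * y'.
Proof. by move=> /andP[c0 c1] *; rewrite lerD // ler_wpM2l // subr_ge0. Qed.

(** Strictness in both values covers the degenerate weights [c = 0] and [c = 1]. *)
Lemma ltr_conv c x y x' y' : 0 <= c <= 1 -> x < x' -> y < y' ->
  c * x + (1 - c) * y < c * x' + (1 - c) * y'.
Proof.
move=> /andP[]; rewrite le0r => /orP[/eqP -> _ _|c0 c1 xx' yy'].
  by rewrite !mul0r !add0r subr0 !mul1r.
by rewrite ltr_leD ?ltr_pM2l // ler_wpM2l ?subr_ge0 // ltW.
Qed.

(** The two sides differ by [(b - a) * (y - x)]. *)
Lemma ler_conv_weight a b x y : a <= b -> x <= y ->
  b * x + (1 - b) * y <= a * x + (1 - a) * y.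
Proof. by move=> ab xy; nra. Qed.

Lemma ltr_conv_weight a b x y : a < b -> x < y ->
  b * x + (1 - b) * y < a * x + (1 - a) * y.
Proof. by move=> ab xy; nra. Qed.

End ConvexCombination.

(** * Mean reciprocals of shifted sums of independent Bernoulli variables *)

Section InverseMean.
Context {R : realType} {V : eqType}.
Implicit Types (a b : V -> R) (s : seq V) (p : {poly R}).

(* For [p] a probability generating function of [N] with [0 < N < n], this is
   [E[1 / N]]; the term [i = 0] vanishes because [0^-1 = 0]. *)
Definition inv_mean n p : R := \sum_(i < n) p`_i / i%:R.

Lemma inv_meanD n p q : inv_mean n (p + q) = inv_mean n p + inv_mean n q.
Proof.
by rewrite -big_split; apply: eq_bigr => i _; rewrite coefD mulrDl.
Qed.

Lemma inv_meanZ n c p : inv_mean n (c *: p) = c * inv_mean n p.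
Proof. by rewrite mulr_sumr; apply: eq_bigr => i _; rewrite coefZ mulrA. Qed.

Lemma inv_mean_sum n (I : Type) (r : seq I) (P : pred I) (F : I -> {poly R}) :
  inv_mean n (\sum_(i <- r | P i) F i) = \sum_(i <- r | P i) inv_mean n (F i).
Proof.
apply: (big_morph _ (inv_meanD n)).
by rewrite /inv_mean big1 // => i _; rewrite coef0 mul0r.
Qed.

Lemma inv_meanXn n k : (k < n)%N -> inv_mean n 'X^k = k%:R^-1.
Proof.
move=> kn; rewrite /inv_mean (bigD1 (Ordinal kn)) //= coefXn eqxx mul1r.
rewrite big1 ?addr0 // => i /negPf ik; rewrite coefXn.
by case: eqP => [e|]; rewrite ?mul0r //; rewrite -val_eqE /= e eqxx in ik.
Qed.

(** Probability generating function of the number of successes in independent trials [y] of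
    probability [a y]. *)
Definition bernoulli_gf a s : {poly R} :=
  \prod_(y <- s) (a y *: 'X + (1 - a y)%:P).

(** This is [E[1 / (k + N)]], with [N] the number of successes along [s], once [0 < k] and
    [k + size s < n]. The offset [k] stores the successes already seen, so that induction on [s]
    works. *)
Definition bernoulli_inv n a k s : R := inv_mean n ('X^k * bernoulli_gf a s).

Lemma bernoulli_inv_nil n a k :
  (k < n)%N -> bernoulli_inv n a k [::] = k%:R^-1.
Proof.
by move=> kn; rewrite /bernoulli_inv /bernoulli_gf big_nil mulr1 inv_meanXn.
Qed.

(** Condition on trial [y]: a success raises the offset by one. *)
Lemma bernoulli_inv_cons n a k y s :
  bernoulli_inv n a k (y :: s) =
  a y * bernoulli_inv n a k.+1 s + (1 - a y) * bernoulli_inv n a k s.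
Proof.
rewrite /bernoulli_inv /bernoulli_gf big_cons -!inv_meanZ -inv_meanD.
congr inv_mean; rewrite -!mul_polyC exprSr; ring.
Qed.

(** The condition [0 < k] matters: at [k = 0] the convention [0^-1 = 0] would break monotonicity. *)
Lemma bernoulli_inv_decr n a k s :
  (forall y, 0 <= a y <= 1) -> (0 < k)%N -> (k.+1 + size s < n)%N ->
  bernoulli_inv n a k.+1 s < bernoulli_inv n a k s.
Proof.
move=> a01; elim: s k => [|y s IH] k k0 /= kn.
  rewrite addn0 in kn; rewrite !bernoulli_inv_nil 1?(ltnW kn) //.
  by rewrite ltf_pV2 ?posrE ?ltr0n // ltr_nat.
rewrite addnS in kn; rewrite !bernoulli_inv_cons ltr_conv //.
  exact: IH.
by apply: IH => //; exact: ltnW.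
Qed.

(** Condition on the head: the tails compare by induction, and raising the weight from [a y] to
    [b y] favours the larger offset, whose value is smaller. *)
Lemma bernoulli_inv_le n a b k s :
  (forall y, 0 <= a y <= 1) -> (forall y, 0 <= b y <= 1) ->
  {in s, forall y, a y <= b y} -> (0 < k)%N -> (k + size s < n)%N ->
  bernoulli_inv n b k s <= bernoulli_inv n a k s.
Proof.
move=> a01 b01; elim: s k => [|y s IH] k /= ab k0 kn.
  by rewrite addn0 in kn; rewrite !bernoulli_inv_nil.
rewrite addnS in kn.
have abs : {in s, forall y, a y <= b y}.
  by move=> z zs; apply: ab; rewrite inE zs orbT.
have h1 := IH k.+1 abs isT kn; have h2 := IH k abs k0 (ltnW kn).
rewrite !bernoulli_inv_cons; apply: le_trans (ler_conv (b01 y) h1 h2) _.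
by rewrite ler_conv_weight ?ab ?mem_head // ltW // bernoulli_inv_decr.
Qed.

(** Strictness comes from the weights when the head is [z], and otherwise from both tails by
    induction. *)
Lemma bernoulli_inv_lt n a b k s z :
  (forall y, 0 <= a y <= 1) -> (forall y, 0 <= b y <= 1) ->
  {in s, forall y, a y <= b y} -> z \in s -> a z < b z ->
  (0 < k)%N -> (k + size s < n)%N ->
  bernoulli_inv n b k s < bernoulli_inv n a k s.
Proof.
move=> a01 b01 ab zs abz; elim: s k ab zs => [//|y s IH] k /= ab zs k0 kn.
rewrite addnS in kn.
have abs : {in s, forall y, a y <= b y}.
  by move=> u us; apply: ab; rewrite inE us orbT.
have h3 := bernoulli_inv_decr a01 k0 kn.
rewrite !bernoulli_inv_cons; move: zs; rewrite inE => /orP[/eqP zy|zs].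
  rewrite zy in abz.
  have h1 : bernoulli_inv n b k.+1 s <= bernoulli_inv n a k.+1 s.
    by apply: bernoulli_inv_le.
  have h2 : bernoulli_inv n b k s <= bernoulli_inv n a k s.
    by apply: bernoulli_inv_le => //; exact: ltnW.
  by apply: le_lt_trans (ler_conv (b01 y) h1 h2) _; exact: ltr_conv_weight.
have h1 := IH k.+1 abs zs isT kn; have h2 := IH k abs zs k0 (ltnW kn).
apply: lt_le_trans (ltr_conv (b01 y) h1 h2) _.
by rewrite ler_conv_weight ?ab ?mem_head // ltW.
Qed.

End InverseMean.

(** * Flip probabilities as mean reciprocals, and their Gibbs weights *)

Section DigitalAnnealer.
Context {R : realType} {V : finType}.
Implicit Types (H : configuration V -> R) (sigma : configuration V).

Definition others (x : V) : seq V := [seq y <- index_enum V | y != x].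

Lemma mem_others x y : (y \in others x) = (y != x).
Proof. by rewrite mem_filter mem_index_enum andbT. Qed.

Lemma size_others x : (1 + size (others x) < #|V|.+1)%N.
Proof.
have -> : size (others x) = #|predC1 x|.
  by rewrite -sum1_size big_filter sum1_card.
by rewrite cardC1 add1n prednK //; apply/card_gt0P; exists x.
Qed.

Lemma DA_flipE H beta sigma x :
  DA_flip H beta sigma x = accept H beta sigma x *
    bernoulli_inv #|V|.+1 (accept H beta sigma) 1 (others x).
Proof.
set a := accept H beta sigma.
(* Expanding the product of [F y + G y] over subsets [S], the power of ['X] records [#|S|], and
   [G x = 0] removes every [S] that misses [x]. *)
pose F y : {poly R} := a y *: 'X.
pose G y : {poly R} := if y == x then 0 else (1 - a y)%:P.
have -> : a x * bernoulli_inv #|V|.+1 a 1 (others x) =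
          inv_mean #|V|.+1 (\prod_y (F y + G y)).
  rewrite -inv_meanZ; congr inv_mean.
  rewrite (bigD1 x) //= {1}/G eqxx addr0 -scalerAl expr1; congr (_ *: (_ * _)).
  rewrite /bernoulli_gf big_filter; apply: eq_bigr => y yx.
  by rewrite /G (negPf yx).
rewrite bigA_distr inv_mean_sum /DA_flip.
rewrite [RHS](bigID (fun S : {set V} => x \in S)) /= [X in _ + X]big1 ?addr0.
  apply: eq_bigr => S xS.
  have -> : \prod_y (if y \in S then F y else G y) =
      ((\prod_(y in S) a y) * (\prod_(y in ~: S) (1 - a y))) *: 'X^#|S|.
    rewrite (bigID (mem S)) /= -mul_polyC rmorphM !rmorph_prod /= mulrAC.
    congr (_ * _).
      rewrite -prodr_const -big_split /=; apply: eq_bigr => y yS.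
      by rewrite yS /F -mul_polyC.
    apply: eq_big => [y|y yS]; first by rewrite inE.
    rewrite (negPf yS) /G; case: eqP => // yx.
    by rewrite yx xS in yS.
  rewrite inv_meanZ inv_meanXn; first by rewrite -mulrA mulrC.
  by rewrite ltnS max_card.
move=> S xS; rewrite (bigD1 x) //= (negPf xS) /G eqxx mul0r.
by rewrite -(scale0r 0) inv_meanZ mul0r.
Qed.

Lemma flipK x : involutive (@flip V ^~ x).
Proof.
move=> sigma; apply/ffunP => y; rewrite !ffunE.
by case: eqP => // _; rewrite negbK.
Qed.

Lemma DA_matrix_neq0 H beta sigma tau : sigma != tau ->
  DA_matrix H beta sigma tau != 0 -> exists x, tau = flip sigma x.
Proof.
rewrite /DA_matrix; case: pickP => [x /eqP -> _ _|_]; first by exists x.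
by rewrite eq_sym => /negPf ->; rewrite eqxx.
Qed.

Lemma energy_gap_flip H sigma x :
  energy_gap H (flip sigma x) x = - energy_gap H sigma x.
Proof. by rewrite /energy_gap flipK opprB. Qed.

Lemma accept_flip H beta sigma x : 0 <= energy_gap H sigma x ->
  accept H beta (flip sigma x) x = 1.
Proof.
move=> g0; rewrite /accept energy_gap_flip (max_idPr _) ?oppr_le0 //.
by rewrite mulr0 oppr0 expR0.
Qed.

(** Detailed balance for the Metropolis acceptance, the reverse flip being accepted surely. In the
    flow comparison it leaves only the factors [E[1 / (1 + N)]]. *)
Lemma gibbs_flip H beta sigma x : 0 <= energy_gap H sigma x ->
  gibbs H beta (flip sigma x) = gibbs H beta sigma * accept H beta sigma x.
Proof.
move=> g0; rewrite !ffunE /accept (max_idPl g0) mulrAC -expRD; congr (expR _ / _).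
rewrite /energy_gap; ring.
Qed.

Lemma gibbs_gt0 H beta sigma : 0 < gibbs H beta sigma.
Proof.
rewrite ffunE divr_gt0 ?expR_gt0 // (bigD1 sigma) //=.
by rewrite ltr_pwDl ?expR_gt0 // sumr_ge0 // => tau _; rewrite expR_ge0.
Qed.

Lemma gibbs_sum1 H beta : \sum_sigma gibbs H beta sigma = 1.
Proof.
under eq_bigr do rewrite ffunE.
rewrite -mulr_suml divff // gt_eqF // (bigD1 [ffun=> true]) //=.
by rewrite ltr_pwDl ?expR_gt0 // sumr_ge0 // => tau _; rewrite expR_ge0.
Qed.

Lemma accept_bounds H beta sigma : 0 < beta ->
  forall y, 0 <= accept H beta sigma y <= 1.
Proof. by move=> b0 y; rewrite accept_le1 // ltW ?accept_gt0. Qed.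

(** * Gibbs flows at a state where no single flip lowers the energy *)

Section GroundState.
Context (H : configuration V -> R) (beta : R) (t : configuration V).
Hypotheses (beta_gt0 : 0 < beta) (gap_ge0 : forall x, 0 <= energy_gap H t x).
Hypothesis gap_flip : forall x y, y != x ->
  energy_gap H (flip t x) y <= energy_gap H t y.

Lemma accept_flip_le x :
  {in others x, forall y, accept H beta t y <= accept H beta (flip t x) y}.
Proof.
move=> y; rewrite mem_others => yx; rewrite ler_expR lerN2 ler_pM2l //.
by rewrite ge_max !le_max (gap_flip yx) lexx orbT.
Qed.

Lemma gibbs_flow_le x :
  gibbs H beta (flip t x) * DA_flip H beta (flip t x) x <=
  gibbs H beta t * DA_flip H beta t x.
Proof.
rewrite gibbs_flip // !DA_flipE accept_flip // mul1r -mulrA.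
rewrite !ler_pM2l ?gibbs_gt0 ?accept_gt0 //.
apply: bernoulli_inv_le (size_others x) => //; try exact: accept_bounds.
exact: accept_flip_le.
Qed.

(** Positivity of the gap at [y] ensures that its decrease survives truncation at 0. *)
Lemma gibbs_flow_lt x y : y != x ->
  energy_gap H (flip t x) y < energy_gap H t y -> 0 < energy_gap H t y ->
  gibbs H beta (flip t x) * DA_flip H beta (flip t x) x <
  gibbs H beta t * DA_flip H beta t x.
Proof.
move=> yx lt gt; rewrite gibbs_flip // !DA_flipE accept_flip // mul1r -mulrA.
rewrite !ltr_pM2l ?gibbs_gt0 ?accept_gt0 //.
apply: (bernoulli_inv_lt (z := y)) (size_others x) => //;
  try exact: accept_bounds.
- exact: accept_flip_le.
- by rewrite mem_others.
- by rewrite ltr_expR ltrN2 ltr_pM2l // (max_idPl (ltW gt)) gt_max lt gt.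
Qed.

Lemma gibbs_not_stationary x y : y != x ->
  energy_gap H (flip t x) y < energy_gap H t y -> 0 < energy_gap H t y ->
  ~ is_stationary (DA_matrix H beta) (gibbs H beta).
Proof.
move=> yx lt gt [_ _ /(_ t) stat].
have [_ /(_ t) row1] := DA_stochastic H beta_gt0.
set P := DA_matrix H beta in stat row1; set mu := gibbs H beta in stat.
(* Row [t] sums to 1, so the net outflows from [t] add up to 0; being nonnegative, they all vanish,
   against strictness at [flip t x]. *)
have sum0 : \sum_s (mu t * P t s - mu s * P s t) = 0.
  by rewrite sumrB -mulr_sumr row1 stat mulr1 subrr.
have term0 s : true -> 0 <= mu t * P t s - mu s * P s t.
  move=> _; rewrite subr_ge0.
  have [->//|st] := eqVneq s t.
  have [Pst|/(DA_matrix_neq0 st)[z tE]] := eqVneq (P s t) 0.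
    rewrite Pst mulr0 mulr_ge0 ?(ltW (gibbs_gt0 _ _ _)) //.
    by have [P0 _] := DA_stochastic H beta_gt0; exact: P0.
  have -> : s = flip t z by rewrite tE flipK.
  rewrite /P DA_matrix_flip -[X in DA_matrix _ _ _ X](flipK z) DA_matrix_flip.
  exact: gibbs_flow_le.
have /(_ (flip t x) isT) := psumr_eq0P term0 sum0.
rewrite /P DA_matrix_flip -[X in DA_matrix _ _ _ X](flipK x) DA_matrix_flip.
move/eqP; rewrite subr_eq0 => /eqP eq.
by have := gibbs_flow_lt yx lt gt; rewrite -/mu eq ltxx.
Qed.

End GroundState.

(** * Energy gaps of the Ising Hamiltonian around the all-plus state *)

Section Ising.
Context (J : V -> V -> R).
Hypotheses (J_ge0 : forall x y, 0 <= J x y) (J_sym : forall x y, J x y = J y x).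
Hypothesis J_diag : forall x, J x x = 0.

Lemma spin_flip sigma x y :
  spin (flip sigma x) y = (if y == x then -1 else 1) * spin sigma y :> R.
Proof.
rewrite /spin ffunE; case: eqP => _; case: (sigma y); rewrite /= ?mul1r //; ring.
Qed.

(** Isolates the dependence on the spin at [x]: by symmetry the two cross sums agree, which absorbs
    the factor 1/2. *)
Lemma ising_split sigma x :
  ising J sigma =
  - (2^-1 * \sum_(u | u != x) \sum_(v | v != x) J u v * spin sigma u * spin sigma v)
  - spin sigma x * \sum_(y | y != x) J x y * spin sigma y.
Proof.
rewrite /ising (bigD1 x) //= (bigD1 x) //= J_diag !mul0r add0r.
rewrite [X in _ + X](eq_bigr (fun u => J x u * spin sigma u * spin sigma x +
  \sum_(v | v != x) J u v * spin sigma u * spin sigma v)); last first.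
  by move=> u ux; rewrite (bigD1 x) //= (J_sym u).
rewrite big_split /= -mulr_suml.
have -> : \sum_(i | i != x) J x i * spin sigma x * spin sigma i =
          spin sigma x * \sum_(y | y != x) J x y * spin sigma y.
  by rewrite mulr_sumr; apply: eq_bigr => y _; rewrite mulrCA mulrA.
by field.
Qed.

Lemma ising_gap sigma x :
  energy_gap (ising J) sigma x =
  2 * spin sigma x * \sum_(y | y != x) J x y * spin sigma y.
Proof.
rewrite /energy_gap !(ising_split _ x) spin_flip eqxx.
have flipE y : y != x -> spin (flip sigma x) y = spin sigma y :> R.
  by move=> /negPf yx; rewrite spin_flip yx mul1r.
under eq_bigr => u ux do
  under eq_bigr => v vx do rewrite (flipE u ux) (flipE v vx).
under [in X in _ - X - _]eq_bigr => y yx do rewrite (flipE y yx).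
ring.
Qed.

Definition all_plus : configuration V := [ffun=> true].

Lemma spin_all_plus x : spin all_plus x = 1 :> R.
Proof. by rewrite /spin ffunE. Qed.

Lemma all_plus_gap x :
  energy_gap (ising J) all_plus x = 2 * \sum_(y | y != x) J x y.
Proof.
rewrite ising_gap spin_all_plus mulr1; congr (_ * _).
by apply: eq_bigr => y _; rewrite spin_all_plus mulr1.
Qed.

(** Only the term of [x] in the local field at [y] changes, from [J x y] to [- J x y]; the factor 2
    of the gap makes this 4. *)
Lemma all_plus_flip_gap x y : y != x ->
  energy_gap (ising J) (flip all_plus x) y =
  energy_gap (ising J) all_plus y - 4 * J x y.
Proof.
move=> yx; rewrite all_plus_gap ising_gap spin_flip (negPf yx) spin_all_plus.
have xy : x != y by rewrite eq_sym.
rewrite (bigD1 x xy) [in RHS](bigD1 x xy) /= spin_flip eqxx spin_all_plus.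
rewrite (eq_bigr (J y)); first by rewrite (J_sym x y); ring.
by move=> z /andP[_ /negPf zx]; rewrite spin_flip zx spin_all_plus !mulr1.
Qed.

Lemma ising_gibbs_not_stationary beta x y : 0 < beta -> J x y != 0 ->
  ~ is_stationary (DA_matrix (ising J) beta) (gibbs (ising J) beta).
Proof.
move=> beta_gt0 Jxy0.
have Jxy : 0 < J x y by rewrite lt_def Jxy0 J_ge0.
have yx : y != x by apply: contraNneq Jxy0 => ->; rewrite J_diag.
apply: (gibbs_not_stationary (t := all_plus) _ _ _ yx) => //.
- by move=> z; rewrite all_plus_gap mulr_ge0 // sumr_ge0.
- by move=> u v vu; rewrite all_plus_flip_gap // gerBl mulr_ge0.
- by rewrite all_plus_flip_gap // gtrBl mulr_gt0.
- rewrite all_plus_gap mulr_gt0 // (bigD1 x) 1?eq_sym //= J_sym.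
  by rewrite ltr_pwDl // sumr_ge0.
Qed.

End Ising.

(** * Constant Hamiltonians *)

Lemma DA_matrix_sym_const H beta c : (forall sigma, H sigma = c) ->
  forall sigma tau, DA_matrix H beta sigma tau = DA_matrix H beta tau sigma.
Proof.
move=> Hc sigma tau.
have acceptE s s' y : accept H beta s y = accept H beta s' y.
  by rewrite /accept /energy_gap !Hc.
have flipE s s' x : DA_flip H beta s x = DA_flip H beta s' x.
  apply: eq_bigr => S _; congr (_ * _ * _); apply: eq_bigr => y _;
    by rewrite (acceptE s s').
have [->//|st] := eqVneq sigma tau.
have [[x ->]|no] := pselect (exists x, tau = flip sigma x).
  rewrite DA_matrix_flip -[X in DA_matrix _ _ _ X](flipK x) DA_matrix_flip.
  exact: flipE.
have z s s' : s != s' -> ~ (exists x, s' = flip s x) ->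
    DA_matrix H beta s s' = 0.
  by move=> ss' n; apply/eqP/negP => /negP /(DA_matrix_neq0 ss').
rewrite !z // 1?eq_sym //.
by case=> x e; apply: no; exists x; rewrite e flipK.
Qed.

(** The Gibbs distribution is uniform, and by symmetry the columns of the matrix sum to 1 like its
    rows. *)
Lemma gibbs_stationary_const H beta c : 0 < beta ->
  (forall sigma, H sigma = c) ->
  is_stationary (DA_matrix H beta) (gibbs H beta).
Proof.
move=> beta_gt0 Hc; split=> [s||t].
- exact/ltW/gibbs_gt0.
- exact: gibbs_sum1.
have gibbsE s : gibbs H beta s = gibbs H beta t by rewrite !ffunE !Hc.
under eq_bigr => s _ do rewrite gibbsE (DA_matrix_sym_const _ Hc).
by rewrite -mulr_sumr; have [_ ->] := DA_stochastic H beta_gt0; rewrite mulr1.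
Qed.

End DigitalAnnealer.

Theorem proposition3p4 (R : realType) (V : finType) (e : rel V)
    (e_sym : symmetric e) (e_irr : irreflexive e)
    (J : V -> V -> R) (J_ge0 : forall x y : V, 0 <= J x y)
    (J_sym : forall x y : V, J x y = J y x)
    (J_supp : forall x y : V, ~~ e x y -> J x y = 0)
    (beta : R) (beta_gt0 : 0 < beta) :
  DA_stationary (ising J) beta = gibbs (ising J) beta
  <-> (forall x y : V, J x y = 0).
Proof.
split=> [eq x y|J0].
  have [//|Jxy] := eqVneq (J x y) 0.
  have J_diag z : J z z = 0 by rewrite J_supp ?e_irr.
  case: (ising_gibbs_not_stationary J_ge0 J_sym J_diag beta_gt0 Jxy).
  exact/DA_stationaryP.
apply/esym/DA_stationaryP => //.
apply: (gibbs_stationary_const (c := 0)) => // sigma.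
rewrite /ising big1 ?mulr0 ?oppr0 // => x _.
by rewrite big1 // => y _; rewrite J0 !mul0r.
Qed.
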